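(* Let $K=I(X,R)$ be the incidence algebra of a locally finite preordered set $X$ over a $T$-algebra $R$, and suppose that $K$ satisfies Condition (II). (a) There are group isomorphisms: 1. $\mathrm{Aut}\,K/\mathrm{Ker}\,f\cong\Omega\cong\Lambda/\Psi$ and $C/\Psi\cong\Omega_1$; 2. $\mathrm{Aut}\,K/\Phi\cong\Omega/\mathrm{In}(\mathrm{Aut}\,L)$. (b) $\mathrm{Out}\,K$ has a normal subgroup $H$ such that $H\cong\Psi/\Psi_0$ and $\mathrm{Out}\,K/H\cong\Omega/\mathrm{In}(\mathrm{Aut}\,L)$. (c) If $\Psi=\Psi_0$, then $\Phi=\mathrm{In}(\mathrm{Aut}\,K)$ and $\mathrm{Out}\,K\cong\Omega/\mathrm{In}(\mathrm{Aut}\,L)$.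
   Context: Rings are associative with nonzero identity. $T$ is a commutative ring, $R$ a $T$-algebra, $(X,\le)$ a preordered set (reflexive, transitive relation) which is locally finite: every interval $[x,y]=\{z: x\le z\le y\}$ is finite. Write $x\sim y$ iff $x\le y$ and $y\le x$; $[x]$ is the $\sim$-class of $x$. $K=I(X,R)$ is the $T$-algebra of functions $f:X\times X\to R$ with $f(x,y)=0$ if $x\not\le y$, with pointwise addition and $T$-action and product $(fg)(x,y)=\sum_{x\le z\le y}f(x,z)g(z,y)$. Put $L=\{f\in K: f(x,y)=0 \text{ if } x\not\sim y\}$ (a subalgebra) and $M=\{f\in K: f(x,y)=0\text{ if }x\sim y\}$ (an ideal), so $K=L\oplus M$. For a class $[x]$, the idempotent $e_x\in L$ has $e_x(t,t)=1$ for $t\in[x]$ and all other values $0$; $R_x=e_xKe_x=e_xLe_x$, and $L=\prod R_x$ over the classes $[x]$. Condition (II): for every $T$-algebra automorphism $\varphi$ of $K$ and every $x\in X$ there is $y\in X$ with $\varphi(e_x)\in e_y+M$. Under Condition (II), $\varphi(M)=M$ for every $\varphi\in\mathrm{Aut}\,K$, so $\varphi$ has the form $\varphi(a+b)=\alpha(a)+(\delta(a)+\beta(b))$ ($a\in L,b\in M$) with $T$-linear $\alpha:L\to L$, $\delta:L\to M$, $\beta:M\to M$, where $\alpha\in\mathrm{Aut}\,L$; write $\varphi=\begin{pmatrix}\alpha&0\\ \delta&\beta\end{pmatrix}$. Notation: $\mathrm{Aut}$ is the group of $T$-algebra automorphisms, $\mathrm{In}(\mathrm{Aut}\,\cdot)$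 the subgroup of inner automorphisms $a\mapsto v^{-1}av$, $\mathrm{Out}\,K=\mathrm{Aut}\,K/\mathrm{In}(\mathrm{Aut}\,K)$. $f:\mathrm{Aut}\,K\to\mathrm{Aut}\,L$ is the homomorphism $f(\varphi)=\alpha$; $\Omega=\mathrm{Im}\,f$ (it contains $\mathrm{In}(\mathrm{Aut}\,L)$); $\Omega_1=\{\alpha\in\Omega:\alpha R_x=R_x\text{ for all }x\in X\}$. $\Lambda$ is the subgroup of diagonal automorphisms ($\delta=0$); $C$ is the subgroup of those $\varphi\in\Lambda$ with $\alpha R_x=R_x$ for all $x$. $\Psi$ is the subgroup of automorphisms with $\alpha=1$, $\delta=0$; $\Psi_0$ is the subgroup of inner automorphisms of $K$ defined by invertible central elements of the ring $L$. $\Phi=\{\varphi\in\mathrm{Aut}\,K:\ \alpha\in\mathrm{In}(\mathrm{Aut}\,L)\}$. *)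

(* Defs.v *)
From HB Require Import structures.
From mathcomp Require Import all_boot all_order all_algebra.
From mathcomp Require Import boolp classical_sets functions cardinality fsbigop.

Set Implicit Arguments.
Unset Strict Implicit.
Unset Printing Implicit Defensive.

Import Order.TTheory GRing.Theory.
Local Open Scope ring_scope.
Local Open Scope quotient_scope.

(** A subgroup of [G : groupType] is an element of the library type
    [groupClosed G]; [subgroup S] is the subgroup [S] as a group. *)
Record subgroup (G : groupType) (S : groupClosed G) :=
  Subgroup { subgroup_val :> G; subgroup_valP : subgroup_val \in S }.

Section Subgroups.
Variable G : groupType.

Section AsGroup.
Variable S : groupClosed G.

Lemma group_closed_groupClosed : group_closed S.
Proof. by split=> [|x y Sx Sy]; [exact: gpred1 | exact: gpredF]. Qed.

HB.instance Definition _ := [isSub for @subgroup_val G S].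
HB.instance Definition _ := [Choice of subgroup S by <:].
HB.instance Definition _ :=
  SubChoice_isSubGroup.Build G (mem S) (subgroup S) group_closed_groupClosed.
End AsGroup.

Definition fullg : {pred G} := predT.
HB.instance Definition _ := isMulClosed.Build G fullg (fun _ _ _ _ => isT).
HB.instance Definition _ := isMul1Closed.Build G fullg isT.
HB.instance Definition _ := isInvClosed.Build G fullg (fun _ _ => isT).

Section Intersection.
Variables S1 S2 : groupClosed G.
Definition interg : {pred G} := [predI S1 & S2].
Lemma intergM : mulg_closed interg.
Proof.
by move=> x y /andP[x1 x2] /andP[y1 y2]; apply/andP; split; apply: gpredM.
Qed.
Lemma interg1 : 1%g \in interg. Proof. by rewrite inE !gpred1. Qed.
Lemma intergV : invg_closed interg.
Proof. by move=> x /andP[x1 x2]; apply/andP; split; apply: gpredVr. Qed.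
HB.instance Definition _ := isMulClosed.Build G interg intergM.
HB.instance Definition _ := isMul1Closed.Build G interg interg1.
HB.instance Definition _ := isInvClosed.Build G interg intergV.
End Intersection.

Definition normal (N H : groupClosed G) : Prop :=
  {subset N <= H} /\ forall x y, x \in N -> y \in H -> (x ^ y)%g \in N.

Section Quotient.
Variables (H N : groupClosed G).

Definition coset_rel : rel (subgroup H) :=
  fun x y => ((val x)^-1 * val y)%g \in N.

Lemma coset_rel_equiv : equiv_class_of coset_rel.
Proof.
split=> [x|x y|y x z]; rewrite /coset_rel ?mulVg ?gpred1//.
- by rewrite -gpredV invgM invgK.
- by move=> xy yz; have := gpredM _ _ xy yz; rewrite -mulgA mulVKg.
Qed.
Definition coset_equiv := EquivRelPack coset_rel_equiv.

(** [H / N], as the set of cosets [x N]; normality is only used for the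
    group structure. *)
Definition quotient & normal N H := {eq_quot coset_equiv}.

Variable nNH : normal N H.
Local Notation Q := (quotient nNH).
HB.instance Definition _ := Choice.on Q.
HB.instance Definition _ := EqQuotient.on Q.

Lemma coset_eqP (x y : subgroup H) :
  reflect (\pi_Q x = \pi_Q y)%qT (coset_rel x y).
Proof. exact: eqmodP. Qed.

Lemma coset_ind (P : Q -> Prop) : (forall x, P (\pi_Q x)) -> forall a, P a.
Proof. by move=> PQ a; rewrite -[a]reprK. Qed.

Definition coset_mul (a b : Q) : Q := \pi_Q (repr a * repr b)%g.
Definition coset_inv (a : Q) : Q := \pi_Q (repr a)^-1%g.
Definition coset_one : Q := \pi_Q 1%g.

Lemma coset_mul_pi x y : coset_mul (\pi_Q x) (\pi_Q y) = \pi_Q (x * y)%g.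
Proof.
apply/coset_eqP; rewrite /coset_rel !valM.
have := reprK (\pi_Q x); move: (repr _) => u /coset_eqP Nux.
have := reprK (\pi_Q y); move: (repr _) => v /coset_eqP Nvy.
rewrite invgM -mulgA (mulgA (val u)^-1%g).
have := nNH.2 _ (val v) Nux (valP v); rewrite conjgE => Nc.
by have := gpredM _ _ Nc Nvy; rewrite -!mulgA mulVKg.
Qed.

Lemma coset_inv_pi x : coset_inv (\pi_Q x) = \pi_Q (x^-1)%g.
Proof.
apply/coset_eqP; rewrite /coset_rel !gmulfV /=.
have := reprK (\pi_Q x); move: (repr _) => u /coset_eqP Nux.
have := nNH.2 _ (val u)^-1%g Nux (gpredVr _ (valP u)).
by rewrite conjgE invgK mulgA mulgA mulgV mul1g -gpredV invgM invgK.
Qed.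

Lemma coset_mulA : associative coset_mul.
Proof.
by elim/coset_ind=> x; elim/coset_ind=> y; elim/coset_ind=> z; rewrite !coset_mul_pi mulgA.
Qed.
Lemma coset_mul1 : left_id coset_one coset_mul.
Proof. by elim/coset_ind=> x; rewrite coset_mul_pi mul1g. Qed.
Lemma coset_1mul : right_id coset_one coset_mul.
Proof. by elim/coset_ind=> x; rewrite coset_mul_pi mulg1. Qed.
Lemma coset_mulV : left_inverse coset_one coset_inv coset_mul.
Proof. by elim/coset_ind=> x; rewrite coset_inv_pi coset_mul_pi mulVg. Qed.
Lemma coset_Vmul : right_inverse coset_one coset_inv coset_mul.
Proof. by elim/coset_ind=> x; rewrite coset_inv_pi coset_mul_pi mulgV. Qed.

HB.instance Definition _ := isGroup.Build Q
  coset_mulA coset_mul1 coset_1mul coset_mulV coset_Vmul.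
End Quotient.
End Subgroups.

Arguments fullg G : clear implicits.
Arguments quotient {G} H N nNH : rename.

Definition isog (G H : groupType) : Prop :=
  exists f : {multiplicative G -> H}, bijective f.

Section Morphisms.
Variables (G H : groupType) (f : UMagmaMorphism.type G H).

Section Preimage.
Variable S : groupClosed H.
Definition preimg : {pred G} := [pred x | f x \in S].
Lemma preimgM : mulg_closed preimg.
Proof. by move=> x y; rewrite !inE gmulfM; apply: gpredM. Qed.
Lemma preimg1 : 1%g \in preimg. Proof. by rewrite inE gmulf1 gpred1. Qed.
Lemma preimgV : invg_closed preimg.
Proof. by move=> x; rewrite !inE gmulfV; apply: gpredVr. Qed.
HB.instance Definition _ := isMulClosed.Build G preimg preimgM.
HB.instance Definition _ := isMul1Closed.Build G preimg preimg1.
HB.instance Definition _ := isInvClosed.Build G preimg preimgV.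

Lemma preimg_normal : normal S (fullg H) -> normal preimg (fullg G).
Proof.
by move=> [_ nS]; split=> // x y Sx _; rewrite inE gmulfJ; apply: nS.
Qed.
End Preimage.

Definition gker : {pred G} := [pred x | f x == 1%g].
Lemma gkerM : mulg_closed gker.
Proof. by move=> x y /eqP fx /eqP fy; rewrite !inE gmulfM fx fy mulg1. Qed.
Lemma gker1 : 1%g \in gker. Proof. by rewrite inE gmulf1. Qed.
Lemma gkerV : invg_closed gker.
Proof. by move=> x /eqP fx; rewrite !inE gmulfV fx invg1. Qed.
HB.instance Definition _ := isMulClosed.Build G gker gkerM.
HB.instance Definition _ := isMul1Closed.Build G gker gker1.
HB.instance Definition _ := isInvClosed.Build G gker gkerV.

Lemma gkerJ x y : x \in gker -> (x ^ y)%g \in gker.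
Proof. by move=> /eqP fx; rewrite !inE gmulfJ fx conj1g. Qed.

Lemma gker_normal : normal gker (fullg G).
Proof. by split=> // x y kx _; apply: gkerJ. Qed.

Definition gim : {pred H} := [pred y | `[< exists x, f x = y >]].
Lemma gimM : mulg_closed gim.
Proof.
move=> _ _ /asboolP[x <-] /asboolP[y <-].
by apply/asboolP; exists (x * y)%g; rewrite gmulfM.
Qed.
Lemma gim1 : 1%g \in gim.
Proof. by apply/asboolP; exists 1%g; rewrite gmulf1. Qed.
Lemma gimV : invg_closed gim.
Proof.
by move=> _ /asboolP[x <-]; apply/asboolP; exists x^-1%g; rewrite gmulfV.
Qed.
HB.instance Definition _ := isMulClosed.Build H gim gimM.
HB.instance Definition _ := isMul1Closed.Build H gim gim1.
HB.instance Definition _ := isInvClosed.Build H gim gimV.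
End Morphisms.

Section AlgebraAutomorphisms.
Variables (T : comNzRingType) (A : algType T).

Definition is_algaut (f : A -> A) : Prop :=
  [/\ linear f, GRing.monoid_morphism f & bijective f].

Record algaut := AlgAut { aut_fun :> A -> A; _ : `[< is_algaut aut_fun >] }.
HB.instance Definition _ := [isSub for aut_fun].
HB.instance Definition _ := [Choice of algaut by <:].

Lemma algautP (f : algaut) : is_algaut f.
Proof. by case: f => f Af; apply/asboolP. Qed.

Lemma algaut_ext (f g : algaut) : f =1 g -> f = g.
Proof. by move=> fg; apply/val_inj/funext. Qed.

Lemma algaut_inj (f : algaut) : injective f.
Proof. by have [_ _ /bij_inj] := algautP f. Qed.

HB.instance Definition _ (f : algaut) :=
  GRing.isLinear.Build T A A *:%R f (let: And3 lf _ _ := algautP f in lf).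
HB.instance Definition _ (f : algaut) :=
  GRing.isMonoidMorphism.Build A A f (let: And3 _ mf _ := algautP f in mf).

Definition mkalgaut (f : A -> A) (Af : is_algaut f) : algaut :=
  AlgAut (asboolT Af).

Lemma algaut_id_subproof : is_algaut idfun.
Proof. by split=> //; exists idfun. Qed.
Definition algaut_id := mkalgaut algaut_id_subproof.

Lemma algaut_comp_subproof (f g : algaut) : is_algaut (f \o g).
Proof.
split; last by apply: bij_comp; [case: (algautP f) | case: (algautP g)].
  by move=> a x y /=; rewrite !linearP.
by split=> [|x y] /=; rewrite ?rmorph1 ?rmorphM.
Qed.
(** The product of [Aut A] is composition: [(f * g) a = f (g a)]. *)
Definition algaut_comp f g := mkalgaut (algaut_comp_subproof f g).

Lemma algaut_inv_exists (f : algaut) :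
  exists g : algaut, cancel f g /\ cancel g f.
Proof.
have [lf mf [g fK gK]] := algautP f.
suff Ag : is_algaut g by exists (mkalgaut Ag).
split; last by exists f.
  by move=> a x y; apply: (canLR fK); rewrite linearP /= !gK.
by split=> [|x y]; apply: (canLR fK); rewrite ?rmorph1 ?rmorphM /= ?gK.
Qed.
Definition algaut_inv f := sval (cid (algaut_inv_exists f)).
Lemma algautK (f : algaut) : cancel f (algaut_inv f).
Proof. by rewrite /algaut_inv; case: cid => g []. Qed.
Lemma algautVK (f : algaut) : cancel (algaut_inv f) f.
Proof. by rewrite /algaut_inv; case: cid => g []. Qed.

Lemma algaut_compA : associative algaut_comp.
Proof. by move=> f g h; apply: algaut_ext. Qed.
Lemma algaut_comp1 : left_id algaut_id algaut_comp.
Proof. by move=> f; apply: algaut_ext. Qed.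
Lemma algaut_1comp : right_id algaut_id algaut_comp.
Proof. by move=> f; apply: algaut_ext. Qed.
Lemma algaut_compV : left_inverse algaut_id algaut_inv algaut_comp.
Proof. by move=> f; apply: algaut_ext => x; rewrite /= algautK. Qed.
Lemma algaut_Vcomp : right_inverse algaut_id algaut_inv algaut_comp.
Proof. by move=> f; apply: algaut_ext => x; rewrite /= algautVK. Qed.
HB.instance Definition _ := isGroup.Build algaut
  algaut_compA algaut_comp1 algaut_1comp algaut_compV algaut_Vcomp.

Lemma algaut1E x : (1%g : algaut) x = x. Proof. by []. Qed.
Lemma algautME (f g : algaut) x : (f * g)%g x = f (g x). Proof. by []. Qed.

Definition inverse_of (v w : A) : Prop := v * w = 1 /\ w * v = 1.

(** [f a = v^-1 a v]; [A] need not be a [unitRingType], so the inverse of [v]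
    is given explicitly. *)
Definition inner_by (f : A -> A) (v : A) : Prop :=
  exists2 w, inverse_of v w & forall a, f a = w * a * v.

Lemma inner_is_algaut v w : inverse_of v w -> is_algaut (fun a => w * a * v).
Proof.
move=> [vw wv]; split.
- by move=> a x y; rewrite mulrDr mulrDl -scalerAr -scalerAl.
- split=> [|x y]; first by rewrite mulr1.
  by rewrite -!mulrA (mulrA v) vw mul1r.
- exists (fun a => v * a * w) => a; rewrite !mulrA ?vw ?wv mul1r -mulrA.
  by rewrite vw mulr1.
  by rewrite wv mulr1.
Qed.

Definition inn : {pred algaut} := [pred f : algaut | `[< exists v, inner_by f v >]].

Lemma inner_byM (f g : algaut) v1 v2 :
  inner_by f v1 -> inner_by g v2 -> inner_by (f * g)%g (v2 * v1).
Proof.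
move=> [w1 [vw1 wv1] fE] [w2 [vw2 wv2] gE]; exists (w1 * w2).
  by split; rewrite mulrA; [rewrite -(mulrA v2) vw1 | rewrite -(mulrA w1) wv2];
    rewrite mulr1.
by move=> a; rewrite algautME gE fE !mulrA.
Qed.

Lemma inner_by1 : inner_by (1%g : algaut) 1.
Proof.
by exists 1 => [|a]; [split; rewrite mulr1 | rewrite mul1r mulr1].
Qed.

Lemma inner_invE (f : algaut) v w :
  inverse_of v w -> (forall a, f a = w * a * v) ->
  forall a, (f^-1)%g a = v * a * w.
Proof.
move=> [vw wv] fE a; apply: (@algaut_inj f).
by rewrite -[LHS]algautME mulgV fE !mulrA wv mul1r -mulrA wv mulr1.
Qed.

Lemma inner_byV (f : algaut) v w :
  inverse_of v w -> (forall a, f a = w * a * v) -> inner_by (f^-1)%g w.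
Proof.
by move=> vw fE; exists v; [case: vw | apply: inner_invE vw fE].
Qed.

Lemma inner_byJ (f g : algaut) v : inner_by f v -> inner_by (f ^ g)%g ((g^-1)%g v).
Proof.
move=> [w [vw wv] fE]; exists ((g^-1)%g w).
  by split; rewrite -rmorphM ?vw ?wv rmorph1.
move=> a; rewrite conjgE !algautME fE !rmorphM.
by rewrite -[X in _ * X * _]algautME mulVg.
Qed.

Lemma innM : mulg_closed inn.
Proof.
move=> f g /asboolP[v1 f1] /asboolP[v2 g2].
by apply/asboolP; exists (v2 * v1); apply: inner_byM.
Qed.
Lemma inn1 : 1%g \in inn. Proof. by apply/asboolP; exists 1; apply: inner_by1. Qed.
Lemma innV : invg_closed inn.
Proof.
by move=> f /asboolP[v [w vw fE]]; apply/asboolP; exists w; apply: inner_byV fE.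
Qed.
HB.instance Definition _ := isMulClosed.Build algaut inn innM.
HB.instance Definition _ := isMul1Closed.Build algaut inn inn1.
HB.instance Definition _ := isInvClosed.Build algaut inn innV.

Lemma innJ f g : f \in inn -> (f ^ g)%g \in inn.
Proof.
by move=> /asboolP[v fv]; apply/asboolP; exists ((g^-1)%g v); apply: inner_byJ.
Qed.

Lemma inn_normal : normal inn (fullg algaut).
Proof. by split=> // f g If _; apply: innJ. Qed.

Definition out : groupType := quotient (fullg algaut) inn inn_normal.
End AlgebraAutomorphisms.

Arguments algaut {T} A.
Arguments inn {T} A.
Arguments inn_normal {T} A.
Arguments out {T} A.

HB.mixin Record isLocallyFinite d X of Order.Preorder d X := {
  finite_itv : forall x y : X, finite_set [set z : X | (x <= z <= y)%O]
}.

(** The point only records that [X] is nonempty, so that the incidence algebra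
    of [X] is a nonzero ring. *)
#[short(type="locFinPreorderType")]
HB.structure Definition LocFinPreorder d :=
  {X of Order.Preorder d X & Pointed X & isLocallyFinite d X}.

(** The equivalence [x ~ y] of the preorder. *)
Definition preeq d (X : preorderType d) : rel X :=
  fun x y => (x <= y)%O && (y <= x)%O.

Record incidence d (X : locFinPreorderType d) (T : comNzRingType)
    (R : algType T) := Incidence {
  inc_fun :> X -> X -> R;
  _ : `[< forall x y, ~~ (x <= y)%O -> inc_fun x y = 0 >]
}.
Arguments incidence {d} X {T} R.

Section IncidenceAlgebra.
Variables (d : Order.disp_t) (X : locFinPreorderType d).
Variables (T : comNzRingType) (R : algType T).
Local Notation K := (incidence X R).
Implicit Types (f g h : K) (x y z t : X).

HB.instance Definition _ := [isSub for @inc_fun d X T R].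
HB.instance Definition _ := [Choice of K by <:].

Definition mkinc (u : X -> X -> R) (u0 : forall x y, ~~ (x <= y)%O -> u x y = 0)
  : K := Incidence (asboolT u0).

Lemma inc_out f x y : ~~ (x <= y)%O -> f x y = 0.
Proof. by case: f => u u0; move/asboolP: (u0); apply. Qed.

Lemma inc_ext f g : (forall x y, f x y = g x y) -> f = g.
Proof. by move=> fg; apply: val_inj; apply/funext => x; apply/funext => y; apply: fg. Qed.

Definition inc_add f g : K := mkinc (u := fun x y => f x y + g x y)
  (fun x y xy => etrans (congr2 +%R (inc_out f xy) (inc_out g xy)) (addr0 0)).
Definition inc_opp f : K := mkinc (u := fun x y => - f x y)
  (fun x y xy => etrans (congr1 -%R (inc_out f xy)) (oppr0 _)).
Definition inc_zero : K := mkinc (u := fun _ _ => 0) (fun _ _ _ => erefl).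
Definition inc_scale (a : T) f : K := mkinc (u := fun x y => a *: f x y)
  (fun x y xy => etrans (congr1 ( *:%R a) (inc_out f xy)) (scaler0 _ a)).

Lemma inc_one_subproof x y : ~~ (x <= y)%O -> (x == y)%:R = 0 :> R.
Proof. by case: eqP => // ->; rewrite Order.PreorderTheory.le_refl. Qed.
Definition inc_one : K := mkinc inc_one_subproof.

Lemma inc_mul_subproof f g x y : ~~ (x <= y)%O ->
  \sum_(z \in [set z | (x <= z <= y)%O]) f x z * g z y = 0.
Proof.
move=> xy; apply: fsbig1 => z /= /andP[xz zy].
by rewrite (Order.PreorderTheory.le_trans xz zy) in xy.
Qed.
Definition inc_mul f g : K := mkinc (inc_mul_subproof f g).

Lemma inc_mulE f g x y (s : seq X) : uniq s ->
    (forall z, (x <= z <= y)%O -> z \in s) ->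
  inc_mul f g x y = \sum_(z <- s) f x z * g z y.
Proof.
move=> us sub; rewrite /inc_mul/=; apply: fsbig_fwiden => // z [_ /negP] /=.
rewrite negb_and => /orP[] n; rewrite /preimage/= (inc_out _ n) ?mul0r//.
by rewrite mulr0.
Qed.

Definition itvseq x y : seq X := finmap.enum_fset (fset_set [set z : X | (x <= z <= y)%O]).
Lemma itvseq_uniq x y : uniq (itvseq x y). Proof. exact: finmap.fset_uniq. Qed.
Lemma mem_itvseq x y z : (z \in itvseq x y) = (x <= z <= y)%O.
Proof.
rewrite /itvseq in_fset_set; last exact: finite_itv.
by apply/idP/idP; rewrite inE. Qed.

Lemma inc_mul_itv f g x y : inc_mul f g x y = \sum_(z <- itvseq x y) f x z * g z y.
Proof. by apply: inc_mulE (itvseq_uniq _ _) _ => z; rewrite mem_itvseq. Qed.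

Lemma inc_addA : associative inc_add.
Proof. by move=> f g h; apply: inc_ext => x y /=; rewrite addrA. Qed.
Lemma inc_addC : commutative inc_add.
Proof. by move=> f g; apply: inc_ext => x y /=; rewrite addrC. Qed.
Lemma inc_add0 : left_id inc_zero inc_add.
Proof. by move=> f; apply: inc_ext => x y /=; rewrite add0r. Qed.
Lemma inc_addN : left_inverse inc_zero inc_opp inc_add.
Proof. by move=> f; apply: inc_ext => x y /=; rewrite addNr. Qed.
HB.instance Definition _ :=
  GRing.isZmodule.Build K inc_addA inc_addC inc_add0 inc_addN.

Lemma inc_mulA : associative inc_mul.
Proof.
move=> f g h; apply: inc_ext => x y; pose s := itvseq x y.
have us := itvseq_uniq x y.
rewrite !(inc_mul_itv _ _ x y).
transitivity (\sum_(z <- s) \sum_(w <- s) f x z * (g z w * h w y)).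
  apply: eq_big_seq => z; rewrite mem_itvseq => /andP[xz zy].
  rewrite (inc_mulE _ _ us) ?mulr_sumr// => w /andP[zw wy].
  by rewrite mem_itvseq wy (Order.PreorderTheory.le_trans xz zw).
rewrite exchange_big; apply: eq_big_seq => w; rewrite mem_itvseq => /andP[xw wy].
rewrite (inc_mulE _ _ us) ?mulr_suml => [|z /andP[xz zw]].
  by apply: eq_bigr => z _; rewrite mulrA.
by rewrite mem_itvseq xz (Order.PreorderTheory.le_trans zw wy).
Qed.

Lemma inc_mul1 : left_id inc_one inc_mul.
Proof.
move=> f; apply: inc_ext => x y; have [xy|xy] := boolP (x <= y)%O; last first.
  by rewrite !inc_out.
rewrite inc_mul_itv (bigD1_seq x) ?itvseq_uniq ?mem_itvseq ?xy ?Order.PreorderTheory.le_refl//=.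
rewrite eqxx mul1r big1 ?addr0// => z zx.
by rewrite eq_sym (negPf zx) mul0r.
Qed.
Lemma inc_1mul : right_id inc_one inc_mul.
Proof.
move=> f; apply: inc_ext => x y; have [xy|xy] := boolP (x <= y)%O; last first.
  by rewrite !inc_out.
rewrite inc_mul_itv (bigD1_seq y) ?itvseq_uniq ?mem_itvseq ?xy ?Order.PreorderTheory.le_refl//=.
rewrite eqxx mulr1 big1 ?addr0// => z zx.
by rewrite (negPf zx) mulr0.
Qed.
Lemma inc_mulDl : left_distributive inc_mul inc_add.
Proof.
move=> f g h; apply: inc_ext => x y; rewrite /= -/(inc_add _ _).
rewrite -!fsbig_split ?finite_itv//=; last exact: finite_itv.
by apply: eq_fsbigr => z _; rewrite mulrDl.
Qed.
Lemma inc_mulDr : right_distributive inc_mul inc_add.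
Proof.
move=> f g h; apply: inc_ext => x y /=.
rewrite -!fsbig_split ?finite_itv//=; last exact: finite_itv.
by apply: eq_fsbigr => z _; rewrite mulrDr.
Qed.
Lemma inc_oner_neq0 : inc_one != 0 :> K.
Proof.
apply/eqP => /(congr1 (fun f : K => f point point)) /= /eqP.
by rewrite eqxx oner_eq0.
Qed.
HB.instance Definition _ := GRing.Zmodule_isNzRing.Build K
  inc_mulA inc_mul1 inc_1mul inc_mulDl inc_mulDr inc_oner_neq0.

Lemma inc_scaleA a b f : inc_scale a (inc_scale b f) = inc_scale (a * b) f.
Proof. by apply: inc_ext => x y /=; rewrite scalerA. Qed.
Lemma inc_scale1 : left_id 1 inc_scale.
Proof. by move=> f; apply: inc_ext => x y /=; rewrite scale1r. Qed.
Lemma inc_scaleDr : right_distributive inc_scale +%R.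
Proof. by move=> a f g; apply: inc_ext => x y /=; rewrite scalerDr. Qed.
Lemma inc_scaleDl f : {morph inc_scale^~ f : a b / a + b}.
Proof. by move=> a b; apply: inc_ext => x y /=; rewrite scalerDl. Qed.
HB.instance Definition _ := GRing.Zmodule_isLmodule.Build T K
  inc_scaleA inc_scale1 inc_scaleDr inc_scaleDl.

Lemma inc_scaleAl (a : T) f g : a *: (f * g) = (a *: f) * g.
Proof.
apply: inc_ext => x y; rewrite [RHS]inc_mul_itv.
rewrite -[LHS]/(a *: inc_mul f g x y) inc_mul_itv scaler_sumr.
by apply: eq_bigr => z _; rewrite scalerAl.
Qed.
Lemma inc_scaleAr (a : T) f g : a *: (f * g) = f * (a *: g).
Proof.
apply: inc_ext => x y; rewrite [RHS]inc_mul_itv.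
rewrite -[LHS]/(a *: inc_mul f g x y) inc_mul_itv scaler_sumr.
by apply: eq_bigr => z _; rewrite scalerAr.
Qed.
HB.instance Definition _ := GRing.Lmodule_isLalgebra.Build T K inc_scaleAl.
HB.instance Definition _ := GRing.Lalgebra_isAlgebra.Build T K inc_scaleAr.

Lemma incM f g x y :
  (f * g) x y = \sum_(z \in [set z | (x <= z <= y)%O]) f x z * g z y.
Proof. by []. Qed.
Lemma incM_seq f g x y :
  (f * g) x y = \sum_(z <- itvseq x y) f x z * g z y.
Proof. exact: inc_mul_itv. Qed.
Lemma inc1 x y : (1 : K) x y = (x == y)%:R. Proof. by []. Qed.
Lemma incD f g x y : (f + g) x y = f x y + g x y. Proof. by []. Qed.
Lemma incN f x y : (- f) x y = - f x y. Proof. by []. Qed.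
Lemma incB f g x y : (f - g) x y = f x y - g x y. Proof. by []. Qed.
Lemma incZ (a : T) f x y : (a *: f) x y = a *: f x y. Proof. by []. Qed.
Lemma inc0 x y : (0 : K) x y = 0. Proof. by []. Qed.
End IncidenceAlgebra.

Section DiagonalPart.
Variables (d : Order.disp_t) (X : locFinPreorderType d).
Variables (T : comNzRingType) (R : algType T).
Local Notation K := (incidence X R).
Implicit Types (f g h : K) (x y z t : X).

Definition diag_pred : {pred K} :=
  [pred f : K | `[< forall x y, ~~ preeq x y -> f x y = 0 >]].

(** The ideal [M]. *)
Definition offdiag : {pred K} :=
  [pred f : K | `[< forall x y, preeq x y -> f x y = 0 >]].

(** The subalgebra [L], as a [T]-algebra. *)
Record diagalg := DiagAlg { diag_val :> K; diag_valP : diag_val \in diag_pred }.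
HB.instance Definition _ := [isSub for diag_val].
HB.instance Definition _ := [Choice of diagalg by <:].
Local Notation L := diagalg.

Lemma diag_predP f :
  reflect (forall x y, ~~ preeq x y -> f x y = 0) (f \in diag_pred).
Proof. exact: asboolP. Qed.
Lemma offdiagP f :
  reflect (forall x y, preeq x y -> f x y = 0) (f \in offdiag).
Proof. exact: asboolP. Qed.

Lemma preeq_refl x : preeq x x.
Proof. by rewrite /preeq Order.PreorderTheory.le_refl. Qed.
Lemma preeq_sym x y : preeq x y = preeq y x.
Proof. by rewrite /preeq andbC. Qed.
Lemma preeq_trans x y z : preeq x y -> preeq y z -> preeq x z.
Proof.
move=> /andP[xy yx] /andP[yz zy].
by rewrite /preeq (Order.PreorderTheory.le_trans xy yz)
           (Order.PreorderTheory.le_trans zy yx).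
Qed.
Lemma preeq_itv x y z : preeq x y -> (x <= z <= y)%O -> preeq x z && preeq z y.
Proof.
move=> /andP[xy yx] /andP[xz zy]; rewrite /preeq xz zy /=.
by rewrite (Order.PreorderTheory.le_trans zy yx)
           (Order.PreorderTheory.le_trans yx xz).
Qed.

Lemma diag_closed : GRing.subsemialg_closed diag_pred.
Proof.
split.
- by apply/diag_predP => x y; rewrite inc1; case: eqP => // ->; rewrite preeq_refl.
- split; first exact/diag_predP.
  move=> f g /diag_predP fL /diag_predP gL; apply/diag_predP => x y xy.
  by rewrite incD fL ?gL ?addr0.
- move=> a f /diag_predP fL; apply/diag_predP => x y xy.
  by rewrite incZ fL ?scaler0.
- move=> f g /diag_predP fL /diag_predP gL; apply/diag_predP => x y xy.
  rewrite incM_seq big1// => z _; have [xz|xz] := boolP (preeq x z); last first.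
    by rewrite fL ?mul0r.
  by rewrite gL ?mulr0//; apply: contra xy => /(preeq_trans xz).
Qed.
HB.instance Definition _ :=
  GRing.SubChoice_isSubAlgebra.Build T K diag_pred L diag_closed.

Lemma diag_valD (a b : L) : diag_val (a + b) = diag_val a + diag_val b.
Proof. exact: (raddfD (val : L -> K)). Qed.
Lemma diag_valZ (c : T) (a : L) : diag_val (c *: a) = c *: diag_val a.
Proof. by []. Qed.
Lemma diag_valM (a b : L) : diag_val (a * b) = diag_val a * diag_val b.
Proof. exact: (rmorphM (val : L -> K)). Qed.
Lemma diag_val1 : diag_val 1 = 1.
Proof. exact: (rmorph1 (val : L -> K)). Qed.

(** The components of [f] in the decomposition [K = L (+) M]. *)
Lemma diag_proj_subproof f x y :
  ~~ (x <= y)%O -> (if preeq x y then f x y else 0) = 0.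
Proof. by case: ifP => // _; apply: inc_out. Qed.
Lemma diag_proj_diag f : mkinc (diag_proj_subproof f) \in diag_pred.
Proof. by apply/diag_predP => x y /= /negPf ->. Qed.
Definition diag_proj f : L := DiagAlg (diag_proj_diag f).
Definition offdiag_proj f : K := f - diag_proj f.

(** The idempotent [e_x], as an element of [L]; it only depends on the class
    of [x]. *)
Lemma idem_subproof x s t :
  ~~ (s <= t)%O -> ((s == t) && preeq s x)%:R = 0 :> R.
Proof. by case: eqP => // ->; rewrite Order.PreorderTheory.le_refl. Qed.
Lemma idem_diag x : mkinc (idem_subproof x) \in diag_pred.
Proof.
by apply/diag_predP => s t /=; case: eqP => // ->; rewrite preeq_refl.
Qed.
Definition idem x : L := DiagAlg (idem_diag x).

(** The corner [R_x = e_x L e_x]. *)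
Definition corner x : set L := [set idem x * a * idem x | a in [set: L]]%classic.

Definition condition_II : Prop :=
  forall (phi : algaut K) x, exists y, phi (idem x) - idem y \in offdiag.

Lemma diag_projE f x y : diag_proj f x y = if preeq x y then f x y else 0.
Proof. by []. Qed.
Lemma diag_projK (a : L) : diag_proj a = a.
Proof.
apply/val_inj/inc_ext => x y; rewrite /= -/(diag_proj a).
by case: ifPn => // xy; rewrite (diag_predP _ (diag_valP a)).
Qed.
Lemma diag_projD : {morph diag_proj : f g / f + g}.
Proof.
move=> f g; apply/val_inj/inc_ext => x y /=.
by case: ifP; rewrite ?addr0.
Qed.
Lemma diag_projZ (a : T) f : diag_proj (a *: f) = a *: diag_proj f.
Proof.
apply/val_inj/inc_ext => x y /=.
by case: ifP; rewrite ?scaler0.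
Qed.
Lemma diag_projM : {morph diag_proj : f g / f * g}.
Proof.
move=> f g; apply/val_inj/inc_ext => x y.
rewrite [LHS]diag_projE [RHS]incM_seq; case: ifPn => xy.
  rewrite incM_seq; apply: eq_big_seq => z; rewrite mem_itvseq.
  by move=> /(preeq_itv xy)/andP[xz zy]; rewrite /= xz zy.
rewrite big1// => z _ /=; case: ifPn => xz; last by rewrite mul0r.
case: ifPn => zy; last by rewrite mulr0.
by rewrite (preeq_trans xz zy) in xy.
Qed.
Lemma diag_proj_eq0 f : (diag_proj f == 0) = (f \in offdiag).
Proof.
apply/eqP/offdiagP => [f0 x y xy|f0].
  by have := congr1 (fun a : L => a x y) f0; rewrite diag_projE xy.
by apply/val_inj/inc_ext => x y /=; case: ifP => // /f0.
Qed.
Lemma offdiag_projP f : offdiag_proj f \in offdiag.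
Proof. by apply/offdiagP => x y xy; rewrite incB diag_projE xy subrr. Qed.

Lemma idemM x f s t : (diag_val (idem x) * f) s t = if preeq s x then f s t else 0.
Proof.
have [st|st] := boolP (s <= t)%O; last by rewrite !inc_out ?if_same.
rewrite incM_seq (bigD1_seq s) ?itvseq_uniq ?mem_itvseq ?st ?Order.PreorderTheory.le_refl//=.
rewrite eqxx /= big1 ?addr0 => [|z zs].
  by case: ifP; rewrite ?mul1r ?mul0r.
by rewrite eq_sym (negPf zs) mul0r.
Qed.
Lemma Midem x f s t : (f * idem x) s t = if preeq t x then f s t else 0.
Proof.
have [st|st] := boolP (s <= t)%O; last by rewrite !inc_out ?if_same.
rewrite incM_seq (bigD1_seq t) ?itvseq_uniq ?mem_itvseq ?st ?Order.PreorderTheory.le_refl//=.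
rewrite eqxx /= big1 ?addr0 => [|z zs].
  by case: ifP; rewrite ?mulr1 ?mulr0.
by rewrite (negPf zs) mulr0.
Qed.

Lemma itvseq_ltl x y z : (x <= z <= y)%O -> ~~ preeq z y ->
  (size (itvseq x z) < size (itvseq x y))%N.
Proof.
move=> /andP[xz zy]; rewrite /preeq zy /= => yz.
have sub : {subset y :: itvseq x z <= itvseq x y}.
  move=> w; rewrite inE mem_itvseq => /orP[/eqP->|].
    by rewrite mem_itvseq (Order.PreorderTheory.le_trans xz zy)
               Order.PreorderTheory.le_refl.
  by rewrite mem_itvseq => /andP[-> /Order.PreorderTheory.le_trans->].
apply: uniq_leq_size sub.
by rewrite /= itvseq_uniq mem_itvseq negb_and yz orbT.
Qed.
Lemma itvseq_ltr x y z : (x <= z <= y)%O -> ~~ preeq x z ->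
  (size (itvseq z y) < size (itvseq x y))%N.
Proof.
move=> /andP[xz zy]; rewrite /preeq xz /= => zx.
have sub : {subset x :: itvseq z y <= itvseq x y}.
  move=> w; rewrite inE mem_itvseq => /orP[/eqP->|].
    by rewrite mem_itvseq (Order.PreorderTheory.le_trans xz zy)
               Order.PreorderTheory.le_refl.
  by rewrite mem_itvseq => /andP[/(Order.PreorderTheory.le_trans xz)-> ->].
apply: uniq_leq_size sub.
by rewrite /= itvseq_uniq mem_itvseq negb_and zx.
Qed.

Lemma offdiag_fixr (f m : K) : m \in offdiag -> f = f * m -> f = 0.
Proof.
move=> /offdiagP m0 fm; apply: inc_ext => x y; rewrite inc0.
have [n] := ubnP (size (itvseq x y)); elim: n => // n IHn in y *.
rewrite ltnS => lexy; rewrite fm incM_seq big_seq big1// => z.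
rewrite mem_itvseq => xzy; have [zy|zy] := boolP (preeq z y).
  by rewrite m0 ?mulr0.
by rewrite IHn ?mul0r// (leq_trans _ lexy)// itvseq_ltl.
Qed.
Lemma offdiag_fixl (f m : K) : m \in offdiag -> f = m * f -> f = 0.
Proof.
move=> /offdiagP m0 fm; apply: inc_ext => x y; rewrite inc0.
have [n] := ubnP (size (itvseq x y)); elim: n => // n IHn in x *.
rewrite ltnS => lexy; rewrite fm incM_seq big_seq big1// => z.
rewrite mem_itvseq => xzy; have [xz|xz] := boolP (preeq x z).
  by rewrite m0 ?mul0r.
by rewrite IHn ?mulr0// (leq_trans _ lexy)// itvseq_ltr.
Qed.

Lemma offdiag_idem x (p c : K) :
  p - idem x \in offdiag -> c \in offdiag -> p * c = c -> c * p = c -> c = 0.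
Proof.
set m := p - _ => mM /offdiagP c0 pc cp.
have pE : p = diag_val (idem x) + m by rewrite /m addrC subrK.
have ec0 : diag_val (idem x) * c = 0.
  apply: (offdiag_fixr mM); rewrite -[in LHS]cp [in LHS]pE mulrDr mulrDr.
  rewrite mulrA (_ : diag_val (idem x) * c * idem x = 0) ?add0r ?mulrA//.
  apply: inc_ext => s t; rewrite Midem idemM inc0.
  case: ifPn => // tx; case: ifPn => // sx; apply: c0.
  by apply: preeq_trans sx _; rewrite preeq_sym.
by apply: (offdiag_fixl mM); rewrite -[in LHS]pc pE mulrDl ec0 add0r.
Qed.

Lemma aut_offdiag : condition_II ->
  forall (phi : algaut K) f, f \in offdiag -> phi f \in offdiag.
Proof.
move=> hII phi b bM; apply/offdiagP => s t st.
have [x mM] := hII (phi^-1)%g s; set p := (phi^-1)%g _ in mM.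
have pp : p * p = p.
  rewrite -rmorphM; congr (_ _); apply: inc_ext => y z; rewrite idemM.
  by rewrite /=; case: (preeq y s); rewrite // andbF.
have phip : phi p = idem s by rewrite -[LHS]algautME mulgV.
suff pbp0 : p * b * p = 0.
  have : diag_val (idem s) * phi b * idem s = 0.
    by rewrite -phip -!rmorphM pbp0 rmorph0.
  move=> /(congr1 (fun f : K => f s t)).
  by rewrite Midem idemM preeq_refl preeq_sym st.
apply: (offdiag_idem mM); rewrite -?mulrA ?pp//; last by rewrite !mulrA pp.
by rewrite -diag_proj_eq0 !diag_projM (eqP (_ : diag_proj b == 0))
   ?mul0r ?mulr0 ?diag_proj_eq0.
Qed.
End DiagonalPart.

Arguments diagalg {d} X {T} R.
Arguments condition_II {d} X {T} R.

Section MatrixForm.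
Variables (d : Order.disp_t) (X : locFinPreorderType d).
Variables (T : comNzRingType) (R : algType T).
Local Notation K := (incidence X R).
Local Notation L := (diagalg X R).

(** The entries [alpha] and [delta] of the matrix of [phi]:
    [phi a = alpha a + delta a] with [alpha a] in [L] and [delta a] in [M]. *)
Definition alpha (phi : algaut K) (a : L) : L := diag_proj (phi a).
Definition delta (phi : algaut K) (a : L) : K := offdiag_proj (phi a).

Lemma alpha_deltaE (phi : algaut K) (a : L) : phi (diag_val a) = diag_val (alpha phi a) + delta phi a.
Proof. by rewrite /alpha /delta /offdiag_proj addrC subrK. Qed.

Hypothesis hII : condition_II X R.

Lemma diag_proj_aut (phi : algaut K) f :
  diag_proj (phi (diag_proj f)) = diag_proj (phi f).
Proof.
have fE : f = diag_val (diag_proj f) + offdiag_proj f by rewrite addrC subrK.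
rewrite [in RHS]fE raddfD diag_projD.
have /eqP -> : diag_proj (phi (offdiag_proj f)) == 0; last by rewrite addr0.
by rewrite diag_proj_eq0 aut_offdiag// offdiag_projP.
Qed.

Lemma alpha_is_algaut phi : is_algaut (alpha phi).
Proof.
split.
- move=> a x y; rewrite /alpha diag_valD diag_valZ linearP.
  by rewrite diag_projD diag_projZ.
- split=> [|x y]; rewrite /alpha ?diag_val1 ?diag_valM ?rmorph1 ?rmorphM.
    by rewrite -diag_val1 diag_projK.
  by rewrite diag_projM.
- exists (alpha (phi^-1)%g) => a; rewrite /alpha diag_proj_aut.
    by rewrite -algautME mulVg diag_projK.
  by rewrite -algautME mulgV diag_projK.
Qed.

(** The homomorphism [f : Aut K -> Aut L]; Condition (II) makes [alpha phi]
    bijective. *)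
Definition diag_aut (phi : algaut K) : algaut L := mkalgaut (alpha_is_algaut phi).

Lemma diag_autM : {morph diag_aut : phi psi / (phi * psi)%g}.
Proof.
move=> phi psi; apply: algaut_ext => a.
by rewrite algautME /= /alpha diag_proj_aut.
Qed.
Lemma diag_aut1 : diag_aut 1%g = 1%g.
Proof. by apply: algaut_ext => a; rewrite /= /alpha diag_projK. Qed.
HB.instance Definition _ :=
  isUMagmaMorphism.Build (algaut K) (algaut L) diag_aut (diag_aut1, diag_autM).

Definition Omega : groupClosed (algaut L) := gim diag_aut.

Definition corner_stab : {pred algaut L} :=
  [pred a : algaut L | `[< forall x, (a @` corner x = corner x)%classic >]].
Lemma corner_stabM : mulg_closed corner_stab.
Proof.
move=> a b /asboolP aR /asboolP bR; apply/asboolP => x.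
by rewrite -[RHS]aR -[in RHS]bR -image_comp.
Qed.
Lemma corner_stab1 : 1%g \in corner_stab.
Proof. by apply/asboolP => x; rewrite image_id. Qed.
Lemma corner_stabV : invg_closed corner_stab.
Proof.
move=> a /asboolP aR; apply/asboolP => x.
rewrite -[in LHS]aR image_comp -[RHS]image_id; congr (_ @` _)%classic.
by apply/funext => u; rewrite -[LHS]/((a^-1 * a)%g u) mulVg.
Qed.
HB.instance Definition _ := isMulClosed.Build (algaut L) corner_stab corner_stabM.
HB.instance Definition _ := isMul1Closed.Build (algaut L) corner_stab corner_stab1.
HB.instance Definition _ := isInvClosed.Build (algaut L) corner_stab corner_stabV.

Definition Omega1 : groupClosed (algaut L) := interg Omega corner_stab.

Definition diagonal : {pred algaut K} :=
  [pred phi : algaut K | `[< forall a : L, delta phi a = 0 >]].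
Lemma diagonalP (phi : algaut K) :
  reflect (forall a : L, phi a = diag_val (alpha phi a)) (phi \in diagonal).
Proof.
apply: (iffP (asboolP _)) => dphi a; first by rewrite alpha_deltaE dphi addr0.
by apply: (addrI (diag_val (alpha phi a))); rewrite -alpha_deltaE addr0.
Qed.
Lemma diagonalM : mulg_closed diagonal.
Proof.
move=> phi psi /diagonalP dphi /diagonalP dpsi; apply/diagonalP => a.
by rewrite /alpha algautME dpsi dphi diag_projK.
Qed.
Lemma diagonal1 : 1%g \in diagonal.
Proof. by apply/diagonalP => a; rewrite /alpha diag_projK. Qed.
Lemma diagonalV : invg_closed diagonal.
Proof.
move=> phi /diagonalP dphi; apply/diagonalP => a; apply: (@algaut_inj _ _ phi).
by rewrite dphi /alpha diag_proj_aut -algautME mulgV diag_projK.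
Qed.
HB.instance Definition _ := isMulClosed.Build (algaut K) diagonal diagonalM.
HB.instance Definition _ := isMul1Closed.Build (algaut K) diagonal diagonal1.
HB.instance Definition _ := isInvClosed.Build (algaut K) diagonal diagonalV.

Definition Lambda : groupClosed (algaut K) := diagonal.
Definition C : groupClosed (algaut K) := interg Lambda (preimg diag_aut corner_stab).

(** [alpha = 1] and [delta = 0]. *)
Definition Psi : groupClosed (algaut K) := interg (gker diag_aut) Lambda.
Definition Phi : groupClosed (algaut K) := preimg diag_aut (inn L).

Definition central_inner : {pred algaut K} :=
  [pred phi : algaut K | `[< exists v w : L,
    [/\ inverse_of v w, forall a, v * a = a * v &
        forall a : K, phi a = diag_val w * a * diag_val v] >]].
Lemma inverse_of_val (v w : L) :
  inverse_of v w -> inverse_of (diag_val v) (diag_val w).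
Proof. by move=> [vw wv]; split; rewrite -diag_valM ?vw ?wv diag_val1. Qed.
Lemma central_innerM : mulg_closed central_inner.
Proof.
move=> phi psi /asboolP[v1 [w1 [[vw1 wv1] c1 phiE]]].
move=> /asboolP[v2 [w2 [[vw2 wv2] c2 psiE]]]; apply/asboolP.
exists (v2 * v1), (w1 * w2); split.
- split; rewrite mulrA; first by rewrite -(mulrA v2) vw1 mulr1.
  by rewrite -(mulrA w1) wv2 mulr1.
- by move=> a; rewrite -mulrA c1 mulrA c2 -mulrA.
- by move=> a; rewrite algautME psiE phiE !diag_valM !mulrA.
Qed.
Lemma central_inner1 : 1%g \in central_inner.
Proof.
apply/asboolP; exists 1, 1; split=> [|a|a].
- by split; rewrite mulr1.
- by rewrite mul1r mulr1.
- by rewrite diag_val1 mul1r mulr1.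
Qed.
Lemma central_innerV : invg_closed central_inner.
Proof.
move=> phi /asboolP[v [w [vw c phiE]]]; apply/asboolP; exists w, v; split.
- by case: vw.
- by move=> a; rewrite -[w * a]mulr1 -vw.1 mulrA -(mulrA w) -c mulrA vw.2 mul1r.
- exact: inner_invE (inverse_of_val vw) phiE.
Qed.
HB.instance Definition _ :=
  isMulClosed.Build (algaut K) central_inner central_innerM.
HB.instance Definition _ :=
  isMul1Closed.Build (algaut K) central_inner central_inner1.
HB.instance Definition _ :=
  isInvClosed.Build (algaut K) central_inner central_innerV.

Definition Psi0 : groupClosed (algaut K) := central_inner.

Lemma Psi_normal_Lambda : normal Psi Lambda.
Proof.
split=> [phi /andP[]//|phi psi /andP[kphi dphi] dpsi].
by apply/andP; split; [apply: gkerJ | apply: gpredJ].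
Qed.
Lemma Psi_normal_C : normal Psi C.
Proof.
split=> [phi /andP[kphi dphi]|phi psi /andP[kphi dphi] /andP[dpsi _]].
  apply/andP; split=> //; suff: diag_aut phi \in corner_stab by [].
  by rewrite (eqP kphi) gpred1.
by apply/andP; split; [apply: gkerJ | apply: gpredJ].
Qed.
Lemma Phi_normal : normal Phi (fullg (algaut K)).
Proof. exact/preimg_normal/inn_normal. Qed.
Lemma inn_normal_Omega : normal (inn L) Omega.
Proof.
split=> [a /asboolP[v [w vw aE]]|a b ia _]; last exact: innJ.
apply/asboolP.
exists (mkalgaut (inner_is_algaut (inverse_of_val vw))); apply: algaut_ext => u.
by rewrite /= /alpha /= -!diag_valM diag_projK aE.
Qed.
Lemma Psi0_normal_Psi : normal Psi0 Psi.
Proof.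
have PsiP phi : phi \in Psi -> forall a : L, phi a = diag_val a.
  move=> /andP[/eqP kphi /diagonalP dphi] a.
  by rewrite dphi -[alpha phi]/(aut_fun (diag_aut phi)) kphi.
split=> [phi /asboolP[v [w [[vw wv] c phiE]]]|phi psi].
  have phi1 (a : L) : phi a = diag_val a.
    by rewrite phiE -!diag_valM -mulrA -c mulrA wv mul1r.
  apply/andP; split; last by apply/diagonalP => a; rewrite /alpha phi1 diag_projK.
  by apply/eqP/algaut_ext => a; rewrite /= /alpha phi1 diag_projK.
move=> /asboolP[v [w [vw c phiE]]] Ppsi; apply/asboolP; exists v, w; split=> // a.
rewrite conjgE !algautME phiE !rmorphM /= !(PsiP _ (gpredVr _ Ppsi)).
by rewrite -[X in _ * X * _]algautME mulVg.
Qed.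
End MatrixForm.

Arguments Lambda {d X T R} hII.
Arguments Psi0 {d} X {T} R.

(* Main.v *)
(** Every automorphism of [K] is, modulo conjugation by an element of [1 + M],
    a diagonal one with the same [alpha] (lemma [diagonalize]). Hence [f] maps
    [Lambda] onto [Omega] with kernel [Psi], and [Phi = In(Aut K) Psi]. An
    automorphism in [Psi] is the identity on [L]; if it is the conjugation by
    [v], then [v] commutes with the idempotents [e_x], so [v] lies in [L] and is
    central there: [Psi] meets [In(Aut K)] in [Psi_0]. The rest is the first
    isomorphism theorem, [H] being the kernel of
    [Out K -> Omega / In(Aut L)], i.e. the image of [Psi] in [Out K]. *)

Require Import Defs.
From HB Require Import structures.
From mathcomp Require Import all_boot all_order all_algebra boolp.

Set Implicit Arguments.
Unset Strict Implicit.
Unset Printing Implicit Defensive.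

Import GRing.Theory.

(** * Isomorphism theorems for quotients of subgroups *)

Section Isomorphisms.
Local Open Scope group_scope.
Local Open Scope quotient_scope.

(** Cancelling [f 1] in [f 1 * f 1 = f 1] gives [f 1 = 1], so a multiplicative map of groups can be
    bundled as a morphism. *)
Lemma exists_morphism (G G' : groupType) (f : G -> G') :
  {morph f : x y / x * y} -> exists g : UMagmaMorphism.type G G', g =1 f.
Proof.
move=> fM; have f1 : f 1 = 1 by apply: (mulgI (f 1)); rewrite -fM !mulg1.
pose m := isUMagmaMorphism.Build G G' f (f1, fM).
by exists (HB.pack_for (UMagmaMorphism.type G G') f m).
Qed.

Lemma inj_surj_bijective (A B : Type) (f : A -> B) :
  injective f -> (forall y, exists x, f x = y) -> bijective f.
Proof.
move=> f_inj /choice[g gK]; exists g => // x.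
exact: f_inj.
Qed.

Lemma inj_surj_isog (G G' : groupType) (f : G -> G') :
  {morph f : x y / x * y} -> injective f -> (forall y, exists x, f x = y) ->
  isog G G'.
Proof.
move=> /exists_morphism[g gE] f_inj f_surj; exists g.
apply: inj_surj_bijective => [x y|y]; first by rewrite !gE; apply: f_inj.
by have [x <-] := f_surj y; exists x; apply: gE.
Qed.

Lemma isog_sym (G G' : groupType) : isog G G' -> isog G' G.
Proof.
move=> [f [g fK gK]]; apply: (@inj_surj_isog _ _ g) => [||x].
- by move=> x y; apply: (canLR fK); rewrite gmulfM !gK.
- exact: can_inj gK.
- by exists (f x).
Qed.

Section Quotient.
Variables (G G' : groupType) (H N : groupClosed G) (nNH : normal N H).
Local Notation Q := (quotient H N nNH).

Lemma coset_piM (x y : subgroup H) : \pi_Q (x * y) = \pi_Q x * \pi_Q y.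
Proof. exact/esym/coset_mul_pi. Qed.

Lemma coset_pi_eq1 (x : subgroup H) : (\pi_Q x == 1) = (val x \in N).
Proof.
rewrite -(gpredV _ (val x)) -[X in X \in _]mulg1 -(val1 (subgroup H)).
by apply/eqP/idP => [/coset_eqP|/(coset_eqP nNH)].
Qed.

Variable f : subgroup H -> G'.
Hypothesis fM : {morph f : x y / x * y}.

(** [g] is [f] on the representative [u] of the coset of [x]; as [u^-1 * x] lies in [N],
    [f u = f x]. *)
Lemma quotient_lift : (forall x, val x \in N -> f x = 1) ->
  exists g : UMagmaMorphism.type Q G', forall x, g (\pi_Q x) = f x.
Proof.
have [f' f'E] := exists_morphism fM => fN.
pose g (a : Q) := f (repr a).
have gE x : g (\pi_Q x) = f x.
  have /coset_eqP uN := reprK (\pi_Q x).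
  have /fN : val ((repr (\pi_Q x))^-1 * x) \in N by rewrite valM gmulfV.
  rewrite -f'E gmulfM gmulfV !f'E => fux.
  by apply: (mulgI (g (\pi_Q x))^-1); rewrite fux mulVg.
have gM : {morph g : a b / a * b}.
  by elim/coset_ind=> x; elim/coset_ind=> y; rewrite -coset_piM !gE fM.
by have [h hE] := exists_morphism gM; exists h => x; rewrite hE.
Qed.

Lemma first_isog : (forall y, exists x, f x = y) ->
  (forall x, (f x == 1) = (val x \in N)) -> isog Q G'.
Proof.
move=> f_surj kerf.
have [|g gE] := quotient_lift; first by move=> x; rewrite -kerf => /eqP.
apply: (@inj_surj_isog _ _ g); first exact: gmulfM.
  apply: gmulf_inj; elim/coset_ind=> x; rewrite gE => /eqP.
  by rewrite kerf -coset_pi_eq1 => /eqP.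
by move=> y; have [x <-] := f_surj y; exists (\pi_Q x).
Qed.
End Quotient.

(** With [f] given on the ambient group, one morphism can be restricted to several subgroups:
    [diag_aut] to [Aut K], [Lambda] and [C], and the projection onto [Out K] to [Psi]. *)
Lemma first_isog_sub (G G' : groupType) (f : UMagmaMorphism.type G G')
    (H N : groupClosed G) (nNH : normal N H) (H' : groupClosed G') :
    (forall x, x \in H -> f x \in H') ->
    (forall y, y \in H' -> exists2 x, x \in H & f x = y) ->
    (forall x, x \in H -> (f x == 1) = (x \in N)) ->
  isog (quotient H N nNH) (subgroup H').
Proof.
move=> fH f_surj kerf.
pose h (x : subgroup H) := Subgroup (fH _ (valP x)).
apply: (@first_isog _ _ _ _ _ h) => [x y|[y yH]|x].
- by apply: val_inj; rewrite [RHS]valM /= -gmulfM -valM.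
- have [x xH fx] := f_surj y yH; exists (Subgroup xH).
  by apply: val_inj; apply: fx.
- by rewrite -kerf //; apply: valP.
Qed.

Lemma exists_coset_map (G : groupType) (N : groupClosed G)
    (nN : normal N (fullg G)) (Q := quotient (fullg G) N nN) :
  exists c : UMagmaMorphism.type G Q,
    forall x, c x = \pi_Q (@Subgroup G (fullg G) x isT).
Proof.
have [x y|c cE] := @exists_morphism G Q
  (fun x => \pi_Q (@Subgroup G (fullg G) x isT)); last by exists c.
by rewrite -coset_piM; congr (\pi_Q _); apply: val_inj.
Qed.
End Isomorphisms.

(** * Invertibility of the elements of [1 + M] *)

Section Diagonalization.
Local Open Scope ring_scope.
Variables (d : Order.disp_t) (X : locFinPreorderType d).
Variables (T : comNzRingType) (R : algType T).
Local Notation K := (incidence X R).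
Local Notation L := (diagalg X R).

Lemma diag_proj_id (f : K) :
  f \in diag_pred (R:=R) -> diag_val (diag_proj f) = f.
Proof. by move=> fL; have := diag_projK (DiagAlg fL) => /(congr1 val). Qed.

Lemma diag_proj1 : diag_proj (1 : K) = 1.
Proof. by rewrite -(diag_val1 X R) diag_projK. Qed.

(** In every nonzero term of [m * m ^+ n] the factor [m x z] forces [z] out of the class of [x], so
    [[z, y]] is strictly smaller than [[x, y]]. *)
Lemma offdiag_expr_eq0 (m : K) n x y : m \in offdiag (R:=R) ->
  (size (itvseq x y) <= n)%N -> (m ^+ n) x y = 0.
Proof.
move=> /offdiagP m0; elim: n x => [|n IHn] x.
  rewrite leqn0 expr0 => /nilP xy; apply: inc_out.
  apply/negP => le_xy; have : x \in itvseq x y.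
    by rewrite mem_itvseq Order.PreorderTheory.le_refl.
  by rewrite xy.
move=> xyn; rewrite exprS incM_seq big_seq big1 // => z.
rewrite mem_itvseq => xzy; have [xz|xz] := boolP (preeq x z).
  by rewrite m0 ?mul0r.
by rewrite IHn ?mulr0 // -ltnS (leq_trans _ xyn) // itvseq_ltr.
Qed.

Lemma offdiag_sum_stable (m : K) n x y : m \in offdiag (R:=R) ->
  (size (itvseq x y) <= n)%N ->
  (\sum_(i < n) m ^+ i) x y = (\sum_(i < size (itvseq x y)) m ^+ i) x y.
Proof.
move=> mM /subnKC <-; elim: (n - _)%N => [|k IHk]; first by rewrite addn0.
by rewrite addnS big_ord_recr incD IHk offdiag_expr_eq0 ?addr0 // leq_addr.
Qed.

Lemma leq_size_itvseq x y z t : (x <= z)%O -> (t <= y)%O ->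
  (size (itvseq z t) <= size (itvseq (X := X) x y))%N.
Proof.
move=> xz ty; apply: uniq_leq_size (itvseq_uniq _ _) _ => u.
rewrite !mem_itvseq => /andP[/(Order.PreorderTheory.le_trans xz)-> ut].
exact: Order.PreorderTheory.le_trans ut ty.
Qed.

(* The geometric series of an element [m] of [M] is a finite sum at each
   [(x, y)], because [m ^+ n] vanishes there as soon as [n] reaches the
   cardinality of [x, y]. *)
Lemma diag_proj1_inverse (v : K) : diag_proj v = 1 ->
  exists2 w : K, inverse_of v w & diag_proj w = 1.
Proof.
move=> v1; suff [w vw] : exists w : K, inverse_of v w.
  exists w => //.
  by rewrite -[LHS]mul1r -[in LHS]v1 -diag_projM vw.1 diag_proj1.
pose m := 1 - v; have vE : v = 1 - m by rewrite subKr.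
have mM : m \in offdiag (R:=R).
  apply/offdiagP => x y xy; have := congr1 (fun a : L => a x y) v1.
  by rewrite diag_projE xy incB => ->; rewrite subrr.
pose S n : K := \sum_(i < n) m ^+ i.
have w0 x y : ~~ (x <= y)%O -> S (size (itvseq x y)) x y = 0.
  exact: inc_out.
pose w := mkinc w0.
have wE x y n : (size (itvseq x y) <= n)%N -> w x y = S n x y.
  by move=> xyn; rewrite [RHS]offdiag_sum_stable.
have vS n : v * S n = 1 - m ^+ n.
  by rewrite vE -opprB mulNr -subrX1 opprB.
have Sv n : S n * v = 1 - m ^+ n.
  rewrite -vS; apply: commr_sym; apply: commr_sum => i _; apply: commrX.
  by rewrite vE; apply: commr_sym; apply: commrB; [apply: commr1|].
exists w; split; apply: inc_ext => x y.
  (* The entries of [w] used here have intervals inside [[x, y]], so one truncation serves for all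
     of them and the product telescopes. *)
  transitivity ((v * S (size (itvseq x y))) x y).
    rewrite !incM_seq; apply: eq_big_seq => z; rewrite mem_itvseq.
    case/andP=> xz zy; rewrite (@wE _ _ (size (itvseq x y))) //.
    exact: leq_size_itvseq.
  by rewrite vS incB offdiag_expr_eq0 ?subr0.
transitivity ((S (size (itvseq x y)) * v) x y).
  rewrite !incM_seq; apply: eq_big_seq => z; rewrite mem_itvseq.
  case/andP=> xz zy; rewrite (@wE _ _ (size (itvseq x y))) //.
  exact: leq_size_itvseq.
by rewrite Sv incB offdiag_expr_eq0 ?subr0.
Qed.

(** * Class idempotents and diagonalization of automorphisms *)

Lemma mul_idem (s t : X) :
  idem R s * idem R t = if preeq s t then idem R s else 0.
Proof.
apply/val_inj/inc_ext => x y; rewrite [LHS]idemM.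
case: ifPn => [xs|xs]; case: ifPn => [st|st] //=.
- by rewrite xs (preeq_trans xs st).
- case: eqVneq => // _; case: (boolP (preeq x t)) => // xt.
  by rewrite (preeq_trans _ xt) // preeq_sym in st.
- by rewrite (negPf xs) andbF.
Qed.

Lemma idem_mul_idem_eq0 (s t : X) (a : L) : ~~ preeq s t ->
  idem R s * a * idem R t = 0.
Proof.
move=> st; apply/val_inj/inc_ext => x y; rewrite [LHS]Midem.
case: ifPn => // yt; rewrite [LHS]idemM; case: ifPn => // xs.
rewrite (diag_predP _ (diag_valP a)) //; apply: contra st => xy.
by rewrite preeq_sym in xs; apply: preeq_trans xs (preeq_trans xy yt).
Qed.

(** At an entry [(x, y)] with [y] outside the class of [x], [e_x f] keeps [f x y] while [f e_x]
    vanishes. *)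
Lemma commute_idem_diag (f : K) :
  (forall x, diag_val (idem R x) * f = f * idem R x) -> f \in diag_pred (R:=R).
Proof.
move=> fC; apply/diag_predP => x y xy.
have := congr1 (fun h : K => h x y) (fC x).
by rewrite idemM Midem preeq_refl preeq_sym (negPf xy).
Qed.

Hypothesis hII : condition_II X R.

(* With [p_s = phi (alpha^-1 e_s)], a family of idempotents congruent to
   the [e_s] modulo [M], the element [v = \sum e_s p_s] of [1 + M] satisfies
   [v p_s = e_s v], so [a |-> v (phi a) v^-1] maps the diagonal idempotents
   [alpha^-1 e_s] to [e_s]. *)
Lemma diagonalize (phi : algaut K) :
  exists eta : algaut K,
    [/\ eta \in inn K, diag_aut hII eta = 1%g & (eta * phi)%g \in Lambda hII].
Proof.
pose A := diag_aut hII phi.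
pose q s : L := (A^-1)%g (idem R s).
have Aq s : A (q s) = idem R s by rewrite -algautME mulgV.
pose p s : K := phi (q s).
have p_diag s : diag_proj (p s) = idem R s by rewrite -Aq.
(* The sum defining [v] is written row by row: only the summand of the class of [x] contributes to
   row [x]. *)
have v0 x y : ~~ (x <= y)%O -> p x x y = 0 by apply: inc_out.
pose v := mkinc v0.
have v1 : diag_proj v = 1.
  apply/val_inj/inc_ext => x y; rewrite [LHS]diag_projE [RHS]inc1.
  case: ifPn => xy; last by case: eqP xy => // ->; rewrite preeq_refl.
  have := congr1 (fun a : L => a x y) (p_diag x).
  by rewrite diag_projE xy /= => ->; rewrite preeq_refl andbT.
have [w [vw wv] w1] := diag_proj1_inverse v1.
have vp y : v * p y = diag_val (idem R y) * v.
  apply: inc_ext => s t; rewrite idemM.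
  (* Row [s] of [v] is row [s] of [p s], and [p s * p y] is the image of [e_s * e_y] under [A^-1]
     followed by [phi]. *)
  transitivity ((p s * p y) s t); first by rewrite !incM_seq.
  rewrite -rmorphM /= -diag_valM -rmorphM mul_idem.
  by case: ifP => // _; rewrite !rmorph0.
have wv' : inverse_of w v by [].
pose eta := mkalgaut (inner_is_algaut wv').
have etaE a : eta a = v * a * w by [].
exists eta; split.
- by apply/asboolP; exists w, v.
- apply/algaut_ext => a; rewrite /= /alpha /= !diag_projM v1 w1 mul1r mulr1.
  exact: diag_projK.
- apply/diagonalP => a; rewrite /alpha diag_proj_id //.
  apply/diag_predP => s t st.
  have vpw y : eta (p y) = diag_val (idem R y).
    by rewrite etaE vp -mulrA vw mulr1.
  (* This product is the image under [eta * phi] of [q s * a * q t], which [A] sends to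
     [e_s * A a * e_t = 0]. *)
  have : diag_val (idem R s) * eta (phi a) * idem R t = 0.
    rewrite -!vpw -!rmorphM /= -!diag_valM.
    suff -> : q s * a * q t = 0.
      by rewrite (_ : diag_val 0 = 0 :> K) // rmorph0 mulr0 mul0r.
    apply: (@algaut_inj _ _ A); transitivity (A (q s) * A a * A (q t)).
      by rewrite !rmorphM.
    by rewrite !Aq idem_mul_idem_eq0 // rmorph0.
  move=> /(congr1 (fun f : K => f s t)).
  by rewrite Midem idemM !preeq_refl.
Qed.

(** * Inner automorphisms, [Psi] and [Phi] *)

Lemma PsiP (phi : algaut K) :
  reflect (forall a : L, phi a = diag_val a) (phi \in Psi hII).
Proof.
apply: (iffP idP) => [/andP[/eqP kphi /diagonalP dphi] a|phi1].
  by rewrite dphi -[alpha phi]/(aut_fun (diag_aut hII phi)) kphi.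
apply/andP; split; last by apply/diagonalP => a; rewrite /alpha phi1 diag_projK.
by apply/eqP/algaut_ext => a; rewrite /= /alpha phi1 diag_projK.
Qed.

Lemma Psi_inn (phi : algaut K) :
  phi \in Psi hII -> (phi \in inn K) = (phi \in Psi0 X R).
Proof.
move=> /PsiP phi1; apply/asboolP/asboolP; last first.
  move=> [v [w [vw _ phiE]]]; exists (diag_val v), (diag_val w) => //.
  exact: inverse_of_val.
move=> [v [w [vw wv] phiE]].
have vC (a : L) : v * diag_val a = diag_val a * v.
  by rewrite -[in LHS]phi1 phiE !mulrA vw mul1r.
(* [Psi0] asks for an inverse inside [L], so [w] needs the same argument as [v]. *)
have wC (a : L) : w * diag_val a = diag_val a * w.
  by rewrite -[in RHS]phi1 phiE -!mulrA vw mulr1.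
have vL : v \in diag_pred (R:=R) by apply: commute_idem_diag => x; rewrite vC.
have wL : w \in diag_pred (R:=R) by apply: commute_idem_diag => x; rewrite wC.
exists (DiagAlg vL), (DiagAlg wL); split=> [|a|a]; last exact: phiE.
- by split; apply: val_inj; rewrite [LHS]diag_valM [RHS]diag_val1.
- by apply: val_inj; rewrite [LHS]diag_valM [RHS]diag_valM vC.
Qed.

(** A unit of [L] is a unit of [K], and conjugation by it maps [L] to itself. *)
Lemma inn_lift (a : algaut L) : a \in inn L ->
  exists2 iota : algaut K, iota \in inn K & diag_aut hII iota = a.
Proof.
move=> /asboolP[v [w vw aE]].
exists (mkalgaut (inner_is_algaut (inverse_of_val vw))).
  apply/asboolP; exists (diag_val v), (diag_val w) => //.
    exact: inverse_of_val.
apply: algaut_ext => u.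
by rewrite /= /alpha /= -!diag_valM diag_projK aE.
Qed.

(** The projection [K -> L] along [M] is multiplicative, so it turns conjugation by [v] into
    conjugation by the diagonal part of [v]. *)
Lemma inn_sub_Phi : {subset inn K <= Phi hII}.
Proof.
move=> phi /asboolP[v [w [vw wv] phiE]]; apply/asboolP.
exists (diag_proj v), (diag_proj w).
  by split; rewrite -diag_projM ?vw ?wv diag_proj1.
by move=> a; rewrite /= /alpha phiE !diag_projM diag_projK.
Qed.

(** Dividing by an inner automorphism with the same [alpha] reduces to [alpha = 1], which
    diagonalization preserves while it kills [delta]. *)
Lemma Phi_decomposition (phi : algaut K) : phi \in Phi hII ->
  exists2 eta, eta \in inn K & (eta * phi)%g \in Psi hII.
Proof.
move=> /inn_lift[iota iota_inn iotaE].
have [eta [eta_inn eta1 eta_diag]] := diagonalize (iota^-1 * phi)%g.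
exists (eta * iota^-1)%g; first by rewrite gpredM ?gpredVr.
rewrite -mulgA; apply/andP; split=> //; apply/eqP.
rewrite [LHS](diag_autM hII) eta1 mul1g diag_autM -[diag_aut _ phi]iotaE.
by rewrite -diag_autM mulVg diag_aut1.
Qed.
End Diagonalization.

(** * Quotients of [Aut K] and [Out K] *)

Theorem theorem6p4 (d : Order.disp_t) (X : locFinPreorderType d)
    (T : comNzRingType) (R : algType T) (hII : condition_II X R) :
  let K := incidence X R in
  let L := diagalg X R in
  (* (a) *)
  [/\ isog (quotient (fullg (algaut K)) (gker (diag_aut hII))
                     (gker_normal (diag_aut hII)))
           (subgroup (Omega hII)),
      isog (subgroup (Omega hII))
           (quotient (Lambda hII) (Psi hII) (Psi_normal_Lambda hII)),
      isog (quotient (C hII) (Psi hII) (Psi_normal_C hII))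
           (subgroup (Omega1 hII)) &
      isog (quotient (fullg (algaut K)) (Phi hII) (Phi_normal hII))
           (quotient (Omega hII) (inn L) (inn_normal_Omega hII))] /\
  (* (b) *)
  (exists (H : groupClosed (out K)) (nH : normal H (fullg (out K))),
      isog (subgroup H) (quotient (Psi hII) (Psi0 X R) (Psi0_normal_Psi hII)) /\
      isog (quotient (fullg (out K)) H nH)
           (quotient (Omega hII) (inn L) (inn_normal_Omega hII))) /\
  (* (c) *)
  (Psi hII =i Psi0 X R ->
      Phi hII =i inn K /\
      isog (out K) (quotient (Omega hII) (inn L) (inn_normal_Omega hII))).
Proof.
move=> K L.
have Omega_diag_aut (phi : algaut K) : diag_aut hII phi \in Omega hII.
  by apply/asboolP; exists phi.
have diag_aut_Lambda a : a \in Omega hII ->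
    exists2 phi, phi \in Lambda hII & diag_aut hII phi = a.
  move=> /asboolP[phi <-]; have [eta [_ eta1 Leta]] := diagonalize hII phi.
  by exists (eta * phi)%g; rewrite // diag_autM eta1 mul1g.
have PsiE phi : phi \in Lambda hII ->
    (diag_aut hII phi == 1%g) = (phi \in Psi hII).
  by move=> Lphi; apply/idP/andP => [|[]].
have part1 : isog (quotient (fullg (algaut K)) _ (gker_normal (diag_aut hII)))
                  (subgroup (Omega hII)).
  apply: (first_isog_sub (f := diag_aut hII)) => [phi _|a|//].
    exact: Omega_diag_aut.
  by move=> /asboolP[phi <-]; exists phi.
have part2 : isog (subgroup (Omega hII))
                  (quotient (Lambda hII) (Psi hII) (Psi_normal_Lambda hII)).
  apply/isog_sym/(first_isog_sub (f := diag_aut hII)) => [phi _||] //.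
  exact: Omega_diag_aut.
have part3 : isog (quotient (C hII) (Psi hII) (Psi_normal_C hII))
                  (subgroup (Omega1 hII)).
  apply: (first_isog_sub (f := diag_aut hII)).
  - by move=> phi /andP[_ Cphi]; apply/andP; split=> //; apply: Omega_diag_aut.
  (* A diagonal lift of [a] is in [C], as stabilizing the corners is a condition on [alpha]
     alone. *)
  - move=> a /andP[/diag_aut_Lambda[phi Lphi <-] Ca].
    by exists phi => //; apply/andP.
  - by move=> phi /andP[Lphi _]; apply: PsiE.
pose Q := quotient (Omega hII) (inn L) (inn_normal_Omega hII).
(* [r] is the composite of [Aut K -> Omega] and the projection modulo [In(Aut L)]. It is onto with
   kernel [Phi], and serves for the last isomorphism of (a) and for (b) and (c). *)
pose r phi : Q := (\pi_Q (Subgroup (Omega_diag_aut phi)))%qT.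
have rM : {morph r : phi psi / (phi * psi)%g}.
  move=> phi psi; rewrite /r -coset_piM; congr (\pi_Q _)%qT.
  by apply: val_inj; apply: diag_autM.
have rE phi : (r phi == 1%g) = (phi \in Phi hII) by rewrite coset_pi_eq1.
have r_surj (y : Q) : exists phi, r phi = y.
  elim/coset_ind: y => -[a aO]; have /asboolP[phi phiE] := aO.
  by exists phi; congr (\pi_Q _)%qT; apply: val_inj.
pose rs (x : subgroup (fullg (algaut K))) := r (val x).
have rsM : {morph rs : x y / (x * y)%g} by move=> x y; rewrite -rM.
have rs_surj y : exists x, rs x = y.
  by have [phi <-] := r_surj y; exists (@Subgroup _ (fullg _) phi isT).
have part4 : isog (quotient (fullg (algaut K)) (Phi hII) (Phi_normal hII)) Q.
  by apply: (first_isog _ rsM rs_surj) => x; apply: rE.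
split=> //; split; last first.
  move=> PsiPsi0; have PhiE : Phi hII =i inn K.
    move=> phi; apply/idP/idP; last exact: inn_sub_Phi.
    (* Up to an inner factor [phi] lies in [Psi], hence in [Psi0], so it is inner. *)
    move=> /Phi_decomposition[eta eta_inn Petaphi].
    by rewrite -(gpredMl _ eta_inn) Psi_inn ?Petaphi -?PsiPsi0.
  split=> //; apply: (first_isog _ rsM rs_surj) => x.
  by rewrite -PhiE; apply: rE.
(* [r] kills the inner automorphisms, so it factors through [Out K]. *)
have [rbar rbarE] : exists rbar : UMagmaMorphism.type (out K) Q,
    forall x, rbar (\pi_(out K) x)%qT = rs x.
  apply: (quotient_lift (inn_normal K) rsM) => x /(inn_sub_Phi hII).
  by rewrite -rE => /eqP.
have [c cE] := exists_coset_map (inn_normal K).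
have c_surj a : exists phi, c phi = a.
  elim/coset_ind: a => x; exists (val x); rewrite cE.
  by congr (\pi_(out K) _)%qT; apply: val_inj.
have rbar_c phi : rbar (c phi) = r phi by rewrite cE rbarE.
have c_ker phi : (c phi == 1%g) = (phi \in inn K) by rewrite cE coset_pi_eq1.
pose H : groupClosed (out K) := gker rbar.
exists H, (gker_normal rbar); split.
  (* The projection [c] maps [Psi] onto [H], because [Phi = In(Aut K) Psi], and [Psi] meets the
     kernel of [c] in [Psi0]. *)
  apply/isog_sym/(first_isog_sub (f := c)) => [phi Pphi|a|phi Pphi].
  - rewrite inE rbar_c rE; case/andP: Pphi => /eqP phi1 _.
    by rewrite inE phi1 gpred1.
  - have [phi <-] := c_surj a; rewrite inE rbar_c rE.
    move=> /Phi_decomposition[eta eta_inn Petaphi].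
    exists (eta * phi)%g; rewrite // gmulfM.
    by move: eta_inn; rewrite -c_ker => /eqP ->; rewrite mul1g.
  - by rewrite c_ker (Psi_inn Pphi).
have rbarM : {morph (fun x : subgroup (fullg (out K)) => rbar (val x)) :
    x y / (x * y)%g} by move=> x y; rewrite valM gmulfM.
apply: (first_isog _ rbarM) => // y.
have [phi <-] := r_surj y.
by exists (@Subgroup _ (fullg _) (c phi) isT); rewrite -rbar_c.
Qed.
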